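(* Let $P$ be a commutative topological ring. Then for every finite non-empty preordered set $\Lambda$, the ring $\mathrm{M}_\Lambda(P)$ is an absolute topological ring if and only if $P$ is an absolute topological ring.
   Context: Rings are associative with identity and nontrivial; topological rings are Hausdorff. A topological ring is called an absolute topological ring if its group of units, with the subspace topology, is a topological group (i.e. inversion is continuous on the units). For a finite (more generally, locally finite) preordered set $(\Lambda,\preceq)$, the incidence ring is $\mathrm{M}_\Lambda(P)=\{(a_{s_1,s_2})\in P^{\Lambda\times\Lambda}: a_{s_1,s_2}\neq 0\Rightarrow s_1\preceq s_2\}$ with coordinatewise addition and multiplication $(ab)_{s_1,s_2}=\sum_{t\in[s_1,s_2]}a_{s_1,t}b_{t,s_2}$, where $[s_1,s_2]=\{t: s_1\preceq t\preceq s_2\}$. It carries the subspace topology from the product topology on $P^{\Lambda\times\Lambda}$. *)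

(* Defs.v *)
From HB Require Import structures.
From mathcomp Require Import all_boot all_order all_algebra.
From mathcomp Require Import all_classical topology tvs.

Set Implicit Arguments.
Unset Strict Implicit.
Unset Printing Implicit Defensive.

Import Order.TTheory GRing.Theory.

Local Open Scope classical_set_scope.
Local Open Scope ring_scope.

(* Topological rings are Hausdorff by convention.  The structure sits over
   possibly trivial rings because the incidence ring of an empty preordered set
   is the zero ring; nontriviality comes from [ComNzRing] for the coefficients
   and from [incidence_ring_oner_neq0] for incidence rings. *)
HB.mixin Record TopologicalZmodule_isTopologicalPzRing R
    & TopologicalZmodule R & GRing.PzRing R := {
  mul_continuous : continuous (fun x : R * R => x.1 * x.2) ;
  ring_hausdorff : hausdorff_space R ;
}.

#[short(type="topologicalPzRingType")]
HB.structure Definition TopologicalPzRing :=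
  {R of TopologicalZmodule R & GRing.PzRing R
        & TopologicalZmodule_isTopologicalPzRing R}.

#[short(type="topologicalComNzRingType")]
HB.structure Definition TopologicalComNzRing :=
  {R of TopologicalPzRing R & GRing.ComNzRing R}.

(* [GRing.unit] and [GRing.inv] need a [unitRingType]; the following agree with
   them there and make sense in every ring. *)
Definition inverse_of (R : pzRingType) (x y : R) : Prop :=
  y * x = 1 /\ x * y = 1.

Definition ring_units (R : pzRingType) : set R :=
  [set x | exists y, inverse_of x y].

Definition ring_inv (R : pzRingType) (x : R) : R := xget x (inverse_of x).

Lemma ring_invP (R : pzRingType) (x : R) :
  ring_units x -> inverse_of x (ring_inv x).
Proof. by move=> [y xy]; exact: (xgetPex x (ex_intro _ y xy)). Qed.

Lemma ring_unitsE (R : unitRingType) :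
  ring_units (R := R) = [set x : R | x \is a GRing.unit].
Proof.
apply/seteqP; split => x /=.
  by move=> [y [yx xy]]; apply/unitrP; exists y.
by move=> /unitrP[y [yx xy]]; exists y.
Qed.

Lemma ring_invE (R : unitRingType) (x : R) : ring_inv x = x^-1.
Proof.
have [ux|nux] := boolP (x \is a GRing.unit).
  have /ring_invP[ix _] : ring_units x by rewrite ring_unitsE.
  by rewrite -[LHS](mulrK ux) ix mul1r.
rewrite invr_out// /ring_inv; apply: xgetPN => y [yx xy].
by case/negP: nux; apply/unitrP; exists y.
Qed.

(* The units form a topological group in the subspace topology.  Only inversion
   is required to be continuous: multiplication always is, as the restriction of
   the multiplication of [R]. *)
Definition absolute_topological_ring (R : topologicalPzRingType) : Prop :=
  {within ring_units (R := R), continuous (@ring_inv R)}.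

Definition incidence_set (d : Order.disp_t) (L : finPreorderType d)
    (P : topologicalPzRingType) :
    set (prod_topology (fun _ : L * L => P)) :=
  [set a | forall s1 s2, a (s1, s2) != 0 -> (s1 <= s2)%O].

(* A set seen as a type carries the subspace topology, here induced by the
   product topology on functions from [L * L] to [P]. *)
Definition incidence_ring (d : Order.disp_t) (L : finPreorderType d)
    (P : topologicalPzRingType) : Type :=
  set_type (incidence_set (L := L) (P := P)).

HB.instance Definition _ d (L : finPreorderType d)
    (P : topologicalPzRingType) :=
  Topological.copy (incidence_ring L P)
    (set_type (incidence_set (L := L) (P := P))).

Section IncidenceRing.
Context (d : Order.disp_t) (L : finPreorderType d) (P : topologicalPzRingType).
Implicit Types a b c : incidence_ring L P.

Definition coef a (s1 s2 : L) : P := set_val a (s1, s2).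

Lemma coef_supp a s1 s2 : coef a s1 s2 != 0 -> (s1 <= s2)%O.
Proof. by move=> h; exact: (set_valP a). Qed.

Lemma coef_eq0 a s1 s2 : ~~ (s1 <= s2)%O -> coef a s1 s2 = 0.
Proof. by move=> h; apply: contraNeq h; exact: coef_supp. Qed.

Lemma coefP a b : coef a =2 coef b -> a = b.
Proof. by move=> ab; apply: val_inj; apply/funext => -[s1 s2]; exact: ab. Qed.

Definition mk_incidence (f : L -> L -> P)
    (hf : forall s1 s2 : L, f s1 s2 != 0 -> (s1 <= s2)%O) : incidence_ring L P :=
  exist _ (fun s : L * L => f s.1 s.2) (mem_set hf).

Lemma coef_mk f hf s1 s2 : coef (@mk_incidence f hf) s1 s2 = f s1 s2.
Proof. by rewrite /coef set_valE. Qed.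

Lemma inc0_supp s1 s2 : (fun _ _ : L => 0 : P) s1 s2 != 0 -> (s1 <= s2)%O.
Proof. by rewrite eqxx. Qed.
Definition inc0 := mk_incidence inc0_supp.

Lemma inc1_supp (s1 s2 : L) : (s1 == s2)%:R != 0 :> P -> (s1 <= s2)%O.
Proof. by case: (s1 =P s2) => [->|] //=; rewrite eqxx. Qed.
Definition inc1 := mk_incidence inc1_supp.

Lemma incN_supp a s1 s2 : - coef a s1 s2 != 0 -> (s1 <= s2)%O.
Proof. by rewrite oppr_eq0; exact: coef_supp. Qed.
Definition incN a := mk_incidence (@incN_supp a).

Lemma incD_supp a b s1 s2 : coef a s1 s2 + coef b s1 s2 != 0 -> (s1 <= s2)%O.
Proof. by apply: contraNT => h; rewrite !coef_eq0// addr0. Qed.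
Definition incD a b := mk_incidence (@incD_supp a b).

Lemma incM_supp a b s1 s2 :
  \sum_(t | (s1 <= t <= s2)%O) coef a s1 t * coef b t s2 != 0 -> (s1 <= s2)%O.
Proof.
apply: contraNT => h; rewrite big_pred0// => t.
by apply/negP => /andP[s1t ts2]; case/negP: h; exact: le_trans ts2.
Qed.
Definition incM a b := mk_incidence (@incM_supp a b).

Lemma coef_incM a b s1 s2 :
  coef (incM a b) s1 s2 = \sum_t coef a s1 t * coef b t s2.
Proof.
rewrite coef_mk big_mkcond/=; apply: eq_bigr => t _.
case: ifPn => // /nandP[] h; first by rewrite (coef_eq0 a h) mul0r.
by rewrite (coef_eq0 b h) mulr0.
Qed.

Lemma incDA : associative incD.
Proof. by move=> a b c; apply: coefP => s1 s2; exact: addrA. Qed.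
Lemma incDC : commutative incD.
Proof. by move=> a b; apply: coefP => s1 s2; exact: addrC. Qed.
Lemma inc0D : left_id inc0 incD.
Proof. by move=> a; apply: coefP => s1 s2; exact: add0r. Qed.
Lemma incND : left_inverse inc0 incN incD.
Proof. by move=> a; apply: coefP => s1 s2; exact: addNr. Qed.

Lemma incMA : associative incM.
Proof.
move=> a b c; apply: coefP => s1 s2; rewrite !coef_incM.
under eq_bigr => t _ do rewrite coef_incM mulr_sumr.
under [RHS]eq_bigr => t _ do rewrite coef_incM mulr_suml.
by rewrite exchange_big; do 2!apply: eq_bigr => ? _; rewrite mulrA.
Qed.

Lemma inc1M : left_id inc1 incM.
Proof.
move=> a; apply: coefP => s1 s2; rewrite coef_incM (bigD1 s1)//= big1 => [|t].
  by rewrite coef_mk eqxx mul1r addr0.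
by rewrite eq_sym coef_mk => /negbTE->; rewrite mul0r.
Qed.

Lemma incM1 : right_id inc1 incM.
Proof.
move=> a; apply: coefP => s1 s2; rewrite coef_incM (bigD1 s2)//= big1 => [|t].
  by rewrite coef_mk eqxx mulr1 addr0.
by rewrite coef_mk => /negbTE->; rewrite mulr0.
Qed.

Lemma incMDl : left_distributive incM incD.
Proof.
move=> a b c; apply: coefP => s1 s2.
rewrite [RHS]coef_mk !coef_incM -big_split.
by apply: eq_bigr => t _; rewrite coef_mk mulrDl.
Qed.

Lemma incMDr : right_distributive incM incD.
Proof.
move=> a b c; apply: coefP => s1 s2.
rewrite [RHS]coef_mk !coef_incM -big_split.
by apply: eq_bigr => t _; rewrite coef_mk mulrDr.
Qed.

HB.instance Definition _ := GRing.isZmodule.Build (incidence_ring L P)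
  incDA incDC inc0D incND.
HB.instance Definition _ := GRing.Zmodule_isPzRing.Build (incidence_ring L P)
  incMA inc1M incM1 incMDl incMDr.

End IncidenceRing.

Lemma incidence_ring_oner_neq0 d (L : finPreorderType d) (P : topologicalComNzRingType) :
  (0 < #|L|)%N -> 1 != 0 :> incidence_ring L P.
Proof.
move=> /card_gt0P[s _]; apply/eqP => /(congr1 (fun a => coef a s s)).
by rewrite !coef_mk eqxx => /eqP; rewrite oner_eq0.
Qed.

Section IncidenceTopology.
Context (d : Order.disp_t) (L : finPreorderType d) (P : topologicalPzRingType).

Lemma coef_continuous s1 s2 :
  continuous (fun a : incidence_ring L P => coef a s1 s2).
Proof.
move=> a; apply: (@continuous_comp _ (prod_topology (fun _ : L * L => P)) _
  set_val (proj (s1, s2))); first exact: initial_continuous.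
exact: proj_continuous.
Qed.

Lemma incidence_continuous (T : topologicalType) (f : T -> incidence_ring L P) :
  (forall s1 s2, continuous (fun x => coef (f x) s1 s2)) -> continuous f.
Proof.
move=> cf; apply: continuous_comp_initial => x.
apply/cvg_sup => -[s1 s2].
exact: (@continuous_comp_initial _ _ _
  (fun g : (forall i : L * L, P) => g (s1, s2)) _ (cf s1 s2)).
Qed.

Lemma coef_pair_continuous (s t u v : L) :
  continuous (fun x : incidence_ring L P * incidence_ring L P =>
    (coef x.1 s t, coef x.2 u v)).
Proof.
move=> x; apply: cvg_pair.
  apply: (@continuous_comp _ _ _ fst (fun a : incidence_ring L P => coef a s t)).
    exact: cvg_fst.
  exact: coef_continuous.
apply: (@continuous_comp _ _ _ snd (fun a : incidence_ring L P => coef a u v)).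
  exact: cvg_snd.
exact: coef_continuous.
Qed.

Lemma incD_continuous :
  continuous (fun x : incidence_ring L P * incidence_ring L P => x.1 + x.2).
Proof.
apply: incidence_continuous => s1 s2 x.
apply: (@continuous_comp _ _ _
  (fun x : incidence_ring L P * incidence_ring L P =>
    (coef x.1 s1 s2, coef x.2 s1 s2)) (fun y : P * P => y.1 + y.2));
  last exact: add_continuous.
exact: coef_pair_continuous.
Qed.

Lemma incN_continuous : continuous (-%R : incidence_ring L P -> _).
Proof.
apply: incidence_continuous => s1 s2 x.
apply: (@continuous_comp _ _ _ (fun a : incidence_ring L P => coef a s1 s2) -%R).
  exact: coef_continuous.
exact: opp_continuous.
Qed.

Lemma incM_continuous :
  continuous (fun x : incidence_ring L P * incidence_ring L P => x.1 * x.2).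
Proof.
apply: incidence_continuous => s1 s2.
under eq_fun do rewrite coef_incM.
move=> x; apply: cvg_big => [|t _]; first exact: add_continuous.
apply: (@continuous_comp _ _ _
  (fun x : incidence_ring L P * incidence_ring L P =>
    (coef x.1 s1 t, coef x.2 t s2)) (fun y : P * P => y.1 * y.2));
  last exact: mul_continuous.
exact: coef_pair_continuous.
Qed.

Lemma incidence_hausdorff : hausdorff_space (incidence_ring L P).
Proof.
move=> a b ab; apply: coefP => s1 s2; apply: ring_hausdorff => U V Ua Vb.
have [c [Uc Vc]] := ab _ _ (coef_continuous Ua) (coef_continuous Vb).
by exists (coef c s1 s2).
Qed.

HB.instance Definition _ := PreTopologicalNmodule_isTopologicalNmodule.Build
  (incidence_ring L P) incD_continuous.
HB.instance Definition _ := TopologicalNmodule_isTopologicalZmodule.Build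
  (incidence_ring L P) incN_continuous.
HB.instance Definition _ := TopologicalZmodule_isTopologicalPzRing.Build
  (incidence_ring L P) incM_continuous incidence_hausdorff.

End IncidenceTopology.

(* Main.v *)
Require Import Defs.
From HB Require Import structures.
From mathcomp Require Import all_boot all_order all_algebra.
From mathcomp Require Import all_classical topology tvs.

Set Implicit Arguments.
Unset Strict Implicit.
Unset Printing Implicit Defensive.

Import Order.TTheory GRing.Theory.

Local Open Scope classical_set_scope.
Local Open Scope ring_scope.

(** Incidence rings over [P] are rings of square matrices over [P].  If a matrix
    [A] has inverse [B], multiplying [\adj A *m A = (\det A)%:M] by [B] gives
    [B = (\det A)^-1 *: \adj A]; the determinant and the adjugate are polynomial
    in the entries, so inversion of matrices is continuous as soon as inversion
    in [P] is.  Conversely, [P] embeds topologically as the scalar matrices, and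
    the inverse of a scalar matrix is read off one of its diagonal entries. *)

(** Two-sided inverses are unique, so the chosen [ring_inv x] may be replaced by any exhibited
    inverse. *)
Lemma ring_inv_eq (R : pzRingType) (x y : R) : inverse_of x y -> ring_inv x = y.
Proof.
move=> xy; have [ix _] : inverse_of x (ring_inv x).
  by apply: ring_invP; exists y.
by rewrite -[LHS]mulr1 -xy.2 mulrA ix mul1r.
Qed.

(** Serves to pull continuity of inversion back along a map that sends units to units. *)
Lemma within_comp_continuous (T U V : topologicalType) (A : set T) (B : set U)
    (f : T -> U) (g : U -> V) :
  continuous f -> (forall x, A x -> B (f x)) -> {within B, continuous g} ->
  {within A, continuous (g \o f)}.
Proof.
move=> cf AB /subspace_continuousP cg; apply/subspace_continuousP => x Ax.
move=> W /(cg _ (AB _ Ax))/cf.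
by apply: (@filterS _ (nbhs x)) => y WB /AB; exact: WB.
Qed.

Section MatrixContinuity.
Context (T : topologicalType) (R : topologicalPzRingType).

Lemma continuousM_ring (f g : T -> R) :
  continuous f -> continuous g -> continuous (fun x => f x * g x).
Proof.
move=> cf cg x; apply: (@continuous_comp _ _ _ (fun x => (f x, g x))
  (fun y : R * R => y.1 * y.2)); last exact: mul_continuous.
by apply: cvg_pair; [exact: cf|exact: cg].
Qed.

Lemma det_continuous n (A : T -> 'M[R]_n) :
  (forall i j, continuous (fun x => A x i j)) ->
  continuous (fun x => \det (A x)).
Proof.
(* Leibniz expansion: a finite sum over permutations of a sign times a product of entries. *)
move=> cA x; apply: cvg_big => [|s _]; first exact: add_continuous.
apply: continuousM_ring => {}x; first exact: cvg_cst.
by apply: cvg_big => [|i _]; [exact: mul_continuous|exact: cA].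
Qed.

Lemma adj_continuous n (A : T -> 'M[R]_n) i j :
  (forall i j, continuous (fun x => A x i j)) ->
  continuous (fun x => (\adj (A x)) i j).
Proof.
move=> cA; under eq_fun do rewrite mxE /cofactor.
apply: continuousM_ring => [x|]; first exact: cvg_cst.
apply: det_continuous => k l; under eq_fun do rewrite !mxE.
exact: cA.
Qed.

End MatrixContinuity.

(** Determinants are multiplicative, and a one-sided inverse of a square matrix over a commutative
    ring is two-sided. *)
Lemma inverse_of_det (R : comPzRingType) n (A B : 'M[R]_n) :
  A *m B = 1%:M -> inverse_of (\det A) (\det B).
Proof. by move=> AB; split; rewrite -det_mulmx ?AB ?(mulmx1C AB) det1. Qed.

Lemma mx_inverse_adj (R : comPzRingType) n (A B : 'M[R]_n) :
  A *m B = 1%:M -> B = ring_inv (\det A) *: \adj A.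
Proof.
move=> AB; rewrite -[\adj A]mulmx1 -AB mulmxA mul_adj_mx mul_scalar_mx scalerA.
by rewrite (ring_inv_eq (inverse_of_det AB)) (inverse_of_det AB).1 scale1r.
Qed.

Section IncidenceMatrix.
Context (d : Order.disp_t) (L : finPreorderType d) (P : topologicalPzRingType).
Implicit Types a b : incidence_ring L P.

(** Determinants and adjugates live on matrices indexed by ordinals, hence the enumeration of [L];
    it may ignore the preorder. *)
Definition incidence_mx a : 'M[P]_#|L| :=
  \matrix_(i, j) coef a (enum_val i) (enum_val j).

Lemma incidence_mxE a s1 s2 :
  incidence_mx a (enum_rank s1) (enum_rank s2) = coef a s1 s2.
Proof. by rewrite mxE !enum_rankK. Qed.

Lemma incidence_mxM a b :
  incidence_mx (a * b) = incidence_mx a *m incidence_mx b.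
Proof.
apply/matrixP => i j; rewrite !mxE coef_incM.
rewrite (reindex _ (onW_bij _ (@enum_val_bij L)))/=.
by apply: eq_bigr => k _; rewrite !mxE.
Qed.

Lemma incidence_mx1 : incidence_mx 1 = 1%:M.
Proof.
by apply/matrixP => i j; rewrite !mxE coef_mk (inj_eq enum_val_inj).
Qed.

Lemma incidence_mx_continuous i j : continuous (fun a => incidence_mx a i j).
Proof. by under eq_fun do rewrite mxE; exact: coef_continuous. Qed.

Lemma scalar_incidence_supp (x : P) (s1 s2 : L) :
  x *+ (s1 == s2) != 0 -> (s1 <= s2)%O.
Proof. by case: (s1 =P s2) => [->|] //=; rewrite mulr0n eqxx. Qed.

Definition scalar_incidence (x : P) : incidence_ring L P :=
  mk_incidence (scalar_incidence_supp (x := x)).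

Lemma coef_scalar x s1 s2 : coef (scalar_incidence x) s1 s2 = x *+ (s1 == s2).
Proof. exact: coef_mk. Qed.

Lemma scalar_incidenceM x y :
  scalar_incidence (x * y) = scalar_incidence x * scalar_incidence y.
Proof.
apply: coefP => s1 s2; rewrite coef_incM (bigD1 s1)//= big1 => [|t].
  by rewrite !coef_scalar eqxx addr0 mulrnAr.
by rewrite eq_sym coef_scalar => /negbTE->; rewrite mul0r.
Qed.

Lemma scalar_incidence1 : scalar_incidence 1 = 1.
Proof. by apply: coefP => s1 s2; rewrite coef_scalar coef_mk. Qed.

Lemma scalar_incidence_inverse x y :
  inverse_of x y -> inverse_of (scalar_incidence x) (scalar_incidence y).
Proof.
by move=> [yx xy]; split; rewrite -scalar_incidenceM ?yx ?xy scalar_incidence1.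
Qed.

Lemma scalar_incidence_continuous : continuous scalar_incidence.
Proof.
apply: incidence_continuous => s1 s2; under eq_fun do rewrite coef_scalar.
by case: (s1 == s2) => x; [exact: cvg_id|exact: cvg_cst].
Qed.

End IncidenceMatrix.

Lemma absolute_incidence_ring_coef d (L : finPreorderType d)
    (P : topologicalPzRingType) (s : L) :
  absolute_topological_ring (incidence_ring L P) ->
  absolute_topological_ring P.
Proof.
move=> cM.
have cS : {within ring_units (R := P),
    continuous (@ring_inv (incidence_ring L P) \o @scalar_incidence d L P)}.
  apply: within_comp_continuous cM; first exact: scalar_incidence_continuous.
  by move=> x [y xy]; exists (scalar_incidence L y);
    exact: scalar_incidence_inverse.
(* Agreement on the units is enough for continuity within them. *)
apply: (@subspace_eq_continuous _ _ _
  (fun x => coef (ring_inv (scalar_incidence L x)) s s)).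
  move=> x /set_mem[y xy].
  rewrite (ring_inv_eq (scalar_incidence_inverse L xy)) coef_scalar eqxx.
  exact/esym/ring_inv_eq.
move=> x; apply: (@continuous_comp _ _ _ _ (fun a => coef a s s) x (cS x)).
exact: coef_continuous.
Qed.

Lemma absolute_incidence_ring d (L : finPreorderType d)
    (P : topologicalComNzRingType) :
  absolute_topological_ring P ->
  absolute_topological_ring (incidence_ring L P).
Proof.
(* The units with their subspace topology serve as the source space, so continuity is checked one
   coefficient at a time. *)
move=> cP; apply: incidence_continuous => s1 s2.
pose A (a : incidence_ring L P) := incidence_mx a.
(* The inverse is taken in the incidence ring, so its support is right from the start and only the
   matrix identity remains. *)
have AV a : ring_units a -> A a *m A (ring_inv a) = 1%:M.
  by move=> /ring_invP[_ aV]; rewrite -incidence_mxM aV incidence_mx1.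
apply: (@subspace_eq_continuous _ _ _ (fun a => ring_inv (\det (A a)) *
    (\adj (A a)) (enum_rank s1) (enum_rank s2))).
  move=> a /set_mem/AV/mx_inverse_adj AVE.
  by rewrite -[RHS]incidence_mxE -/(A _) AVE [RHS]mxE.
apply: continuousM_ring.
  apply: within_comp_continuous cP.
    by apply: det_continuous => i j; exact: incidence_mx_continuous.
  by move=> a /AV/inverse_of_det ?; exists (\det (A (ring_inv a))).
apply: continuous_subspaceT.
by apply: adj_continuous => i j; exact: incidence_mx_continuous.
Qed.

Theorem corollary3p7 (P : topologicalComNzRingType) (d : Order.disp_t)
    (L : finPreorderType d) (hL : (0 < #|L|)%N) :
  absolute_topological_ring (incidence_ring L P) <->
  absolute_topological_ring P.
Proof.
split; last exact: absolute_incidence_ring.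
(* A point of [L] supplies the diagonal entry to read. *)
by have /card_gt0P[s _] := hL; exact: (absolute_incidence_ring_coef s).
Qed.
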